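(* Let $S$ be the set containing 8 copies of each odd positive integer and 4 copies of each even positive integer, and let $T$ be the set containing 4 copies of each odd positive integer, 10 copies of each positive multiple of 4, and 6 copies of each positive integer congruent to 2 modulo 4. Let $D_S(N)$ (respectively, $D_T(N)$) be the number of partitions of $N$ into distinct elements of $S$ (respectively, $T$). Then, for every integer $N\geq 1$, $$D_S(N)=8\,D_T(N-1).$$
   Context: A ''set containing several copies'' of certain integers means a set of colored integers: the different copies of the same integer are regarded as distinct (distinguishable) elements, each having that integer as its value. A partition of $N$ into distinct elements of $X$ is a finite subset of $X$ whose elements have values summing to $N$ (so each copy is used at most once, but different copies of the same integer may be used together, and subsets using different copies are counted as different). The empty partition is the unique partition of $0$. No restriction is imposed on the number of parts. *)

(* Defs.v *)
From mathcomp Require Import all_boot finmap.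

Set Implicit Arguments.
Unset Strict Implicit.
Unset Printing Implicit Defensive.

Local Open Scope fset_scope.

(* The pair (n, c) is the copy of the integer n that has colour c. *)
Definition colored : Type := (nat * nat)%type.

Definition value (x : colored) : nat := x.1.

(* The set containing copies n copies of each positive integer n. *)
Definition colored_set (copies : nat -> nat) : {pred colored} :=
  [pred x : colored | (0 < x.1) && (x.2 < copies x.1)].

Definition is_partition (copies : nat -> nat) (N : nat) (A : {fset colored}) :=
  (forall x, x \in A -> x \in colored_set copies) /\ \sum_(x <- A) value x = N.

Definition colored_upto (copies : nat -> nat) (N : nat) : {fset colored} :=
  [fset x in [seq (n, c) | n <- iota 1 N, c <- iota 0 (copies n)]].

(* Values are positive, so every element of a partition of N has value at most
   N; partitionsP shows that nothing is lost by this bound. *)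
Definition partitions (copies : nat -> nat) (N : nat) : {fset {fset colored}} :=
  [fset A in fpowerset (colored_upto copies N) | \sum_(x <- A) value x == N].

Definition num_partitions (copies : nat -> nat) (N : nat) : nat :=
  #|` partitions copies N|.

Definition copiesS (n : nat) : nat := if odd n then 8 else 4.

Definition copiesT (n : nat) : nat :=
  if odd n then 4 else if 4 %| n then 10 else 6.

Definition D_S (N : nat) : nat := num_partitions copiesS N.

Definition D_T (N : nat) : nat := num_partitions copiesT N.

Lemma in_colored_upto copies N (x : colored) :
  (x \in colored_upto copies N) = (x \in colored_set copies) && (value x <= N).
Proof.
rewrite /colored_upto !inE; apply/allpairsPdep/idP.
  move=> [n [c [+ + ->]]] /=; rewrite !mem_iota add1n ltnS add0n /value /=.
  by move=> /andP[-> ->] ->.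
case: x => n c /= /andP[/andP[n0 cn] nN]; exists n, c.
by rewrite !mem_iota add1n ltnS add0n n0 cn.
Qed.

Lemma partitionsP copies N (A : {fset colored}) :
  reflect (is_partition copies N A) (A \in partitions copies N).
Proof.
rewrite /partitions !inE /= fpowersetE; apply: (iffP andP).
  move=> [/fsubsetP sA /eqP sumA]; split=> // x /sA.
  by rewrite in_colored_upto => /andP[].
move=> [sA sumA]; split; last exact/eqP.
apply/fsubsetP => x xA; rewrite in_colored_upto sA //=.
by rewrite -sumA (big_rem x) //= leq_addr.
Qed.

(* Main.v *)
Require Import Defs.
From mathcomp Require Import all_boot finmap.
From mathcomp Require Import all_algebra ring zify.
Import GRing.Theory.

(** Write (u; t) for the infinite product of the [1 - u t^i], i >= 0. Grouping
    the factors of the two generating functions by the parity of the part turns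
    the claim into the identity of formal power series
      a^8 b^4 = 1 + 8 q a^4 b^6 c^4,
    where a = (-q; q^2), b = (-q^2; q^2), c = (-q^4; q^4).

    This is a statement about the theta series phi(q), the sum of the q^(j^2)
    over all integers j. Its exponents j^2 are 4 i^2 for j = 2i and
    8 i(i+1)/2 + 1 for j = 2i + 1, so that phi(q) = F + q P and
    phi(-q) = F - q P with F and P series in q^4; hence
      phi(q)^2 - phi(-q)^2 = 4 q F P.
    The Jacobi triple product writes phi(q), phi(-q), F and P as infinite
    products. With E_k = (q^k; q^k) they become
      phi(q) = a^2 E_2,  phi(-q) = E_2 / (a b)^2,  F P = 2 c^2 E_8^2,
    and E_8 = E_2 b c. Dividing by E_2^2 and multiplying by a^4 b^4 gives the
    identity.

    Everything is computed in an arbitrary commutative ring R at an element x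
    with x^M = 0, which is eventually the class of 'X in Z['X] / 'X^(N+1). An
    infinite product then coincides with each of its long finite truncations, a
    theta series has finitely many nonzero terms, and no limit is needed. The
    triple product comes from its finite form ([finite_triple_product]), whose
    coefficients are Gaussian binomials; [jacobi_triple_product] is its stable
    form, [phi_dissect] the decomposition F + q P and [product_identity] the
    identity above. The counting is [coef_partition_gf]. *)

Set Implicit Arguments.
Unset Strict Implicit.
Unset Printing Implicit Defensive.

(** * Splitting an iterated operation by parity *)

Lemma big_ord_double (T : Type) (idx : T) (op : Monoid.com_law idx)
    (F : nat -> T) n :
  \big[op/idx]_(i < n.*2) F i =
  op (\big[op/idx]_(i < n) F i.*2) (\big[op/idx]_(i < n) F i.*2.+1).
Proof.
elim: n => [|n IHn]; first by rewrite !big_ord0 Monoid.mulm1.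
by rewrite doubleS !big_ord_recr /= IHn Monoid.mulmACA Monoid.mulmA.
Qed.

Lemma big_ord_doubleS (T : Type) (idx : T) (op : Monoid.com_law idx)
    (F : nat -> T) n :
  \big[op/idx]_(i < n.*2.+1) F i =
  op (\big[op/idx]_(i < n.+1) F i.*2) (\big[op/idx]_(i < n) F i.*2.+1).
Proof. by rewrite !big_ord_recr /= big_ord_double Monoid.mulmAC. Qed.

(** * Nilpotent elements and truncated infinite products *)

Section QSeries.

Local Open Scope ring_scope.

Variable R : comNzRingType.
Implicit Types (t u v x : R) (m n k M : nat).

Lemma nilp_expr t M n : t ^+ M = 0 -> (M <= n)%N -> t ^+ n = 0.
Proof. by move=> tM Mn; rewrite -(subnK Mn) exprD tM mulr0. Qed.

Lemma nilp_exprX t M n : t ^+ M = 0 -> (0 < n)%N -> (t ^+ n) ^+ M = 0.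
Proof.
by move=> tM n0; rewrite -exprM; apply: (nilp_expr tM); rewrite leq_pmull.
Qed.

(** Regularity is what allows the cancellations in R, which has zero divisors;
    it comes from the geometric series. *)
Lemma lreg_nilp t M : t ^+ M = 0 -> GRing.lreg (1 - t).
Proof.
move=> tM; apply: (@GRing.lregMl _ (\sum_(i < M) t ^+ i)).
have -> : (\sum_(i < M) t ^+ i) * (1 - t) = 1.
  have := subrX1 t M; rewrite tM sub0r mulrC => /(congr1 -%R).
  by rewrite opprK -mulrN opprB.
exact: lreg1.
Qed.

(** The sign convention is that of partitions into distinct parts: this is the
    q-Pochhammer symbol (-u; t)_n. *)
Definition qpoch u t n : R := \prod_(i < n) (1 + u * t ^+ i).

Lemma qpochS u t n : qpoch u t n.+1 = qpoch u t n * (1 + u * t ^+ n).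
Proof. by rewrite /qpoch big_ord_recr. Qed.

Lemma qpochSl u t n : qpoch u t n.+1 = (1 + u) * qpoch (u * t) t n.
Proof.
rewrite /qpoch big_ord_recl expr0 mulr1; congr (_ * _).
by apply: eq_bigr => i _; rewrite exprS mulrA.
Qed.

Lemma qpoch_stable u t M n :
  t ^+ M = 0 -> (M <= n)%N -> qpoch u t n = qpoch u t M.
Proof.
move=> tM; elim: n => [|n IHn]; first by rewrite leqn0 => /eqP->.
rewrite leq_eqVlt => /orP[/eqP-> // | Mn].
by rewrite qpochS (nilp_expr tM) // mulr0 addr0 mulr1 IHn.
Qed.

Lemma qpoch_dissect u t M : t ^+ M = 0 ->
  qpoch u t M = qpoch u (t ^+ 2) M * qpoch (u * t) (t ^+ 2) M.
Proof.
move=> tM; rewrite -(@qpoch_stable u t M M.*2) //; last by lia.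
rewrite /qpoch (big_ord_double _ (fun i => 1 + u * t ^+ i)) /=.
by congr (_ * _); apply: eq_bigr => i _;
  rewrite -exprM mul2n // -mulrA -exprS.
Qed.

(** For u = t this is (t; t) (-t; t) = (t^2; t^2), and for u = x, t = x^2 it is
    (-x; x^2) (x; x^2) = (x^2; x^4). *)
Lemma qpochN u t n :
  qpoch u t n * qpoch (- u) t n = qpoch (- u ^+ 2) (t ^+ 2) n.
Proof.
rewrite /qpoch -big_split; apply: eq_bigr => i _ /=.
rewrite exprAC; ring.
Qed.

Lemma lreg_qpoch u t M n : t ^+ M = 0 -> u ^+ M = 0 -> GRing.lreg (qpoch u t n).
Proof.
move=> tM uM; rewrite /qpoch; elim/big_ind: _ => [||i _]; first exact: lreg1.
  exact: lregM.
rewrite -[u * _]opprK; apply: (@lreg_nilp _ M).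
by rewrite -mulNr exprMn exprNn uM mulr0 mul0r.
Qed.

(** * Gaussian binomials *)

(** Defined by the Pascal rule, as no division is available in R. *)
Fixpoint qbin t m k : R :=
  match m, k with
  | _, 0 => 1
  | 0, _.+1 => 0
  | m'.+1, k'.+1 => qbin t m' k' + t ^+ k'.+1 * qbin t m' k
  end.

Lemma qbin0 t m : qbin t m 0 = 1. Proof. by case: m. Qed.

Lemma qbin_small t m k : (m < k)%N -> qbin t m k = 0.
Proof.
by elim: m k => [|m IHm] [|k] //= mk; rewrite !IHm ?(ltnW mk) ?mulr0 ?addr0.
Qed.

Lemma qbinS t m k :
  qbin t m.+1 k.+1 = qbin t m k + t ^+ k.+1 * qbin t m k.+1.
Proof. by []. Qed.

(** The Pascal rule that results from the symmetry of Gaussian binomials. Both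
    rules are needed: each lengthens one of the two factors of
    [finite_triple_product]. *)
Lemma qbinS' t m k : (k <= m)%N ->
  qbin t m.+1 k.+1 = t ^+ (m - k) * qbin t m k + qbin t m k.+1.
Proof.
elim: m k => [|m IHm] k km.
  move: km; rewrite leqn0 => /eqP-> /=.
  by rewrite mulr0 addr0 expr0 mul1r addr0.
rewrite qbinS; case: (leqP k m) => [km' | mk]; last first.
  have -> : k = m.+1 by apply/eqP; rewrite eqn_leq km mk.
  by rewrite subnn !(@qbin_small t m.+1 m.+2) // mulr0 mul1r.
case: k km km' => [|k] km km'.
  by rewrite {1}(IHm 0%N) // qbinS !qbin0 !subn0 expr1 exprS; ring.
rewrite {1}(IHm k.+1) // (qbinS t m k.+1) {1}(IHm k) 1?ltnW // (qbinS t m k).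
have -> : (m - k = (m - k.+1).+1)%N by lia.
have -> : (m.+1 - k.+1 = (m - k.+1).+1)%N by lia.
rewrite !exprS; ring.
Qed.

(** The formula [k+l, k] = (t; t)_(k+l) / ((t; t)_k (t; t)_l), cleared of its
    denominators. *)
Lemma qbin_qpoch t k l :
  qbin t (k + l) k * (qpoch (- t) t k * qpoch (- t) t l)
    = qpoch (- t) t (k + l).
Proof.
elim: k l => [|k IHk] l; first by rewrite qbin0 mul1r /qpoch big_ord0 mul1r.
elim: l => [|l IHl].
  have := IHk 0%N; rewrite !addn0 [qpoch _ _ 0]/qpoch big_ord0 mulr1 => H.
  by rewrite mulr1 qbinS (@qbin_small t k k.+1) // mulr0 addr0 qpochS mulrA H.
rewrite addSn qbinS addnS [qpoch _ _ (k + l).+2]qpochS.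
have Hk := IHk l.+1; rewrite addnS in Hk.
rewrite addSn in IHl.
(* The induction hypotheses reduce the claim to
   (1 - t^(k+1)) + t^(k+1) (1 - t^(l+1)) = 1 - t^(k+l+2). *)
transitivity
  (qbin t (k + l).+1 k * (qpoch (- t) t k * qpoch (- t) t l.+1)
     * (1 - t * t ^+ k)
   + t ^+ k.+1 * (1 - t * t ^+ l)
     * (qbin t (k + l).+1 k.+1 * (qpoch (- t) t k.+1 * qpoch (- t) t l))).
  by rewrite (qpochS _ _ k) (qpochS _ _ l) exprS; ring.
rewrite Hk IHl !exprS exprD; ring.
Qed.

Lemma sum_qbinS t s (f : nat -> R) :
  \sum_(k < s.+2) f k * qbin t s.+1 k
    = \sum_(k < s.+1) (f k * t ^+ k + f k.+1) * qbin t s k.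
Proof.
rewrite big_ord_recl /=.
under eq_bigr => k _ do rewrite /bump /= add1n mulrDr mulrA.
rewrite big_split /=.
have -> : \sum_(k < s.+1) (f k * t ^+ k + f k.+1) * qbin t s k =
  \sum_(k < s.+2) f k * t ^+ k * qbin t s k
  + \sum_(k < s.+1) f k.+1 * qbin t s k.
  rewrite [in RHS]big_ord_recr /= (@qbin_small t s s.+1) // mulr0 addr0.
  by rewrite -big_split; apply: eq_bigr => k _; rewrite mulrDl.
rewrite [in RHS]big_ord_recl /= expr0 mulr1 qbin0.
by rewrite mulr1 [X in _ + X = _]addrC addrA.
Qed.

Lemma sum_qbinS' t s (f : nat -> R) :
  \sum_(k < s.+2) f k * qbin t s.+1 k
    = \sum_(k < s.+1) (f k + f k.+1 * t ^+ (s - k)) * qbin t s k.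
Proof.
rewrite big_ord_recl.
under eq_bigr => k _ do
  rewrite lift0 qbinS' -1?ltnS ?ltn_ord // mulrDr mulrA addrC.
rewrite big_split /=.
have -> : \sum_(k < s.+1) (f k + f k.+1 * t ^+ (s - k)) * qbin t s k =
  \sum_(k < s.+2) f k * qbin t s k
  + \sum_(k < s.+1) f k.+1 * t ^+ (s - k) * qbin t s k.
  rewrite [in RHS]big_ord_recr /= (@qbin_small t s s.+1) // mulr0 addr0.
  by rewrite -big_split; apply: eq_bigr => k _; rewrite mulrDl.
by rewrite [in RHS]big_ord_recl /= qbin0 addrA.
Qed.

(** * The Jacobi triple product *)

(** The triangular number j (j + 1) / 2 of the integer j = k - n. One of the two
    truncated differences vanishes, and for negative j the triangular number is
    'C(-j, 2). Exchanging k and n gives j (j - 1) / 2. *)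
Definition tri k n : nat := 'C((k - n).+1, 2) + 'C(n - k, 2).

Lemma binS2 n : 'C(n.+1, 2) = ('C(n, 2) + n)%N.
Proof. by rewrite binS bin1. Qed.

Lemma binS2_mul2 n : ('C(n.+1, 2) * 2 = n * n.+1)%N.
Proof. by elim: n => [|n IHn]; rewrite binS2 ?bin0n // mulnDl IHn; nia. Qed.

Lemma tri_swap k n : (tri n k + k = tri k n + n)%N.
Proof.
rewrite /tri; case: (leqP k n) => kn; rewrite !binS2.
  by rewrite (_ : k - n = 0)%N ?bin0n; lia.
by rewrite (_ : n - k = 0)%N ?bin0n; lia.
Qed.

Lemma triSl k n : (tri k.+1 n + n = tri k n + k.+1)%N.
Proof.
rewrite /tri; case: (leqP n k) => nk.
  have -> : (k.+1 - n = (k - n).+1)%N by lia.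
  have [-> ->] : (n - k.+1 = 0 /\ n - k = 0)%N by lia.
  by rewrite !binS2 bin0n; lia.
have [-> ->] : (k.+1 - n = 0 /\ k - n = 0)%N by lia.
have -> : (n - k = (n - k.+1).+1)%N by lia.
by rewrite !binS2 bin0n; lia.
Qed.

Lemma triSr k n : (tri k n.+1 + k = tri k n + n)%N.
Proof.
rewrite /tri; case: (leqP k n) => kn.
  have [-> ->] : (k - n.+1 = 0 /\ k - n = 0)%N by lia.
  have -> : (n.+1 - k = (n - k).+1)%N by lia.
  by rewrite !binS2 bin0n; lia.
have [-> ->] : (n.+1 - k = 0 /\ n - k = 0)%N by lia.
have -> : (k - n = (k - n.+1).+1)%N by lia.
by rewrite !binS2 bin0n; lia.
Qed.

(** The term of index j = k - n of Ramanujan's theta series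
    f(u, v) = sum over j of u^(j(j+1)/2) v^(j(j-1)/2). Here f(x, x) is phi(x),
    and f(x, 1) is twice the sum of the x^(j(j+1)/2) over j >= 0. Two parameters
    without inverses replace the variable z, 1/z of the usual triple product. *)
Definition theta_term u v n k : R := u ^+ tri k n * v ^+ tri n k.

Lemma theta_term_up u v m n k : (k <= m + n)%N ->
  theta_term u v n k.+1 * (u * v) ^+ (m + n - k)
    = theta_term u v n k * (u * (u * v) ^+ m).
Proof.
move=> kmn; rewrite /theta_term.
transitivity
  (u ^+ (tri k.+1 n + (m + n - k)) * v ^+ (tri n k.+1 + (m + n - k))).
  by rewrite !exprD exprMn; ring.
have -> : (tri k.+1 n + (m + n - k) = tri k n + m.+1)%N.
  by have := triSl k n; lia.
have -> : (tri n k.+1 + (m + n - k) = tri n k + m)%N.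
  by have := triSr n k; lia.
by rewrite !exprD exprMn exprS; ring.
Qed.

Lemma theta_termSS u v n k : theta_term u v n.+1 k.+1 = theta_term u v n k.
Proof. by rewrite /theta_term /tri !subSS. Qed.

Lemma theta_term_down u v n k :
  theta_term u v n.+1 k * (u * v) ^+ k
    = theta_term u v n k * (v * (u * v) ^+ n).
Proof.
rewrite /theta_term.
transitivity (u ^+ (tri k n.+1 + k) * v ^+ (tri n.+1 k + k)).
  by rewrite !exprD exprMn; ring.
by rewrite triSr triSl !exprD exprMn exprS; ring.
Qed.

(** By induction on both lengths: a new factor of either product splits each
    term of the sum as one of the two Pascal rules splits the Gaussian binomial. *)
Lemma finite_triple_product u v m n :
  qpoch u (u * v) m * qpoch v (u * v) n =
  \sum_(k < (m + n).+1) theta_term u v n k * qbin (u * v) (m + n) k.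
Proof.
elim: m => [|m IHm].
  elim: n => [|n IHn].
    by rewrite big_ord1 /= /theta_term /qpoch !big_ord0 !expr0 !mulr1.
  rewrite add0n in IHn *.
  rewrite qpochS mulrA IHn sum_qbinS mulr_suml; apply: eq_bigr => k _.
  by rewrite theta_termSS theta_term_down; ring.
rewrite addSn sum_qbinS' qpochS mulrAC IHm mulr_suml; apply: eq_bigr => k _.
by rewrite theta_term_up -1?ltnS ?ltn_ord //; ring.
Qed.

(** For |j| = d, both exponents of the term are at least 'C(d, 2), so it is a
    multiple of (u v)^'C(d, 2); and 'C(M + 2, 2) >= M. *)
Lemma theta_term_far u v M n k : (u * v) ^+ M = 0 ->
  (n + M.+2 <= k)%N || (k + M.+2 <= n)%N -> theta_term u v n k = 0.
Proof.
move=> tM H; have binM d : (M.+2 <= d -> M <= 'C(d, 2))%N.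
  by move=> Md; rewrite (leq_trans _ (leq_bin2l 2 Md)) // !binS2; lia.
have [c ca cb] : exists2 c : nat, (M <= c <= tri k n)%N & (c <= tri n k)%N.
  case/orP: H => H.
    exists 'C(k - n, 2); rewrite /tri ?binS2; last lia.
    by rewrite binM /=; lia.
  exists 'C(n - k, 2); rewrite /tri ?binS2; last lia.
  by rewrite binM /=; lia.
case/andP: ca => Mc ca.
rewrite /theta_term -(subnK ca) -(subnK cb) !exprD mulrACA -exprMn.
by rewrite (nilp_expr tM Mc) mulr0.
Qed.

(** In the finite form with both lengths n, the binomial [2n, k] times (t; t),
    for t = u v, is 1 as soon as k and 2n - k are at least M, and the terms for
    all the other k vanish because n is large. *)
Lemma jacobi_triple_product u v M n : (u * v) ^+ M = 0 -> (M.*2.+2 <= n)%N ->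
  \sum_(k < n.*2.+1) theta_term u v n k =
  qpoch u (u * v) M * qpoch v (u * v) M * qpoch (- (u * v)) (u * v) M.
Proof.
move=> tM nM; set t := u * v.
have Mn : (M <= n)%N by lia.
rewrite -(qpoch_stable u tM Mn) -(qpoch_stable v tM Mn) finite_triple_product.
rewrite mulr_suml addnn; apply: eq_bigr => k _.
have [far|near] := boolP ((n + M.+2 <= k) || (k + M.+2 <= n))%N.
  by rewrite (theta_term_far tM far) !mul0r.
have := ltn_ord k; rewrite ltnS => kn.
rewrite -/t -mulrA.
suff -> : qbin t n.*2 k * qpoch (- t) t M = 1 by rewrite mulr1.
have := qbin_qpoch t k (n.*2 - k); rewrite subnKC //.
rewrite !(qpoch_stable _ tM); try lia.
rewrite mulrA mulrC => H.
apply: (@lreg_qpoch (- t) t M M tM); first by rewrite exprNn tM mulr0.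
by rewrite mulr1.
Qed.

(** * The theta series phi *)

(** The sum of the two triangular numbers of j is j^2; hence the factor 4. *)
Lemma tri_square k n :
  (tri k.*2 n.*2 + tri n.*2 k.*2 = 4 * (tri k n + tri n k))%N.
Proof.
have H i j : ((tri i j + tri j i) = (i - j) ^ 2 + (j - i) ^ 2)%N.
  rewrite /tri.
  have := binS2_mul2 (i - j); have := binS2_mul2 (j - i).
  by rewrite !binS2; nia.
by rewrite !H -!doubleB -!muln2 !expnMn; lia.
Qed.

(** (2j + 1)^2 = 8 j(j+1)/2 + 1. *)
Lemma tri_pronic k n :
  (tri k.*2.+1 n.*2 + tri n.*2 k.*2.+1 = 8 * tri k n + 1)%N.
Proof.
have H1 := triSl k.*2 n.*2; have H2 := triSr n.*2 k.*2.
have H3 := tri_square k n; have H4 := tri_swap k n.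
lia.
Qed.

(** The series identity phi(x) = f(x^4, x^4) + x f(x^8, 1). *)
Lemma theta_dissect x M h : x ^+ M = 0 -> (M.+2 <= h)%N ->
  \sum_(k < h.*2.*2.+1) theta_term x x h.*2 k =
  \sum_(k < h.*2.+1) theta_term (x ^+ 4) (x ^+ 4) h k
  + x * \sum_(k < h.*2.+1) theta_term (x ^+ 8) 1 h k.
Proof.
move=> xM Mh; rewrite big_ord_doubleS /=.
congr (_ + _).
  apply: eq_bigr => k _.
  by rewrite /theta_term -!exprD -exprM tri_square.
(* There is one odd index less than there are even ones, so the last term of
   the second series on the right has no partner: it vanishes. *)
rewrite big_ord_recr /= (@theta_term_far (x ^+ 8) 1 M); first last.
- by apply/orP; left; lia.
- by rewrite mulr1 nilp_exprX.
rewrite addr0 mulr_sumr; apply: eq_bigr => k _.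
by rewrite /theta_term expr1n mulr1 -exprD tri_pronic exprD expr1 exprM mulrC.
Qed.

Lemma qpoch_one_self t M : t ^+ M = 0 -> qpoch 1 t M = 2%:R * qpoch t t M.
Proof.
by move=> tM; rewrite -(qpoch_stable 1 tM (leqnSn M)) qpochSl mul1r.
Qed.

(** The same decomposition of phi(x), with each theta series replaced by its
    product. *)
Lemma phi_dissect x M : x ^+ M = 0 ->
  qpoch x (x ^+ 2) M ^+ 2 * qpoch (- x ^+ 2) (x ^+ 2) M =
  qpoch (x ^+ 4) (x ^+ 8) M ^+ 2 * qpoch (- x ^+ 8) (x ^+ 8) M
  + x * (2%:R * qpoch (x ^+ 8) (x ^+ 8) M ^+ 2
           * qpoch (- x ^+ 8) (x ^+ 8) M).
Proof.
move=> xM; have := @theta_dissect x M M.*2.+2 xM.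
have nil := nilp_exprX xM.
have xx : x * x = x ^+ 2 by [].
have x4 : x ^+ 4 * x ^+ 4 = x ^+ 8 by rewrite -exprD.
rewrite (@jacobi_triple_product x x M) ?xx ?nil //; last lia.
rewrite (@jacobi_triple_product (x ^+ 4) (x ^+ 4) M) ?x4 ?nil //.
rewrite (@jacobi_triple_product (x ^+ 8) 1 M) ?mulr1 ?nil //.
rewrite qpoch_one_self ?nil // => ->; last lia.
by ring.
Qed.

(** The difference of the squares of the decompositions of phi(x) and phi(-x),
    after division by E_2^2 and multiplication by a^4 b^4. *)
Lemma product_identity x M : x ^+ M = 0 ->
  qpoch x (x ^+ 2) M ^+ 8 * qpoch (x ^+ 2) (x ^+ 2) M ^+ 4 =
  1 + 8%:R * x * (qpoch x (x ^+ 2) M ^+ 4 * qpoch (x ^+ 2) (x ^+ 2) M ^+ 6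
                * qpoch (x ^+ 4) (x ^+ 4) M ^+ 4).
Proof.
move=> xM; have nil := nilp_exprX xM.
have phi := phi_dissect xM.
have := @phi_dissect (- x) M; rewrite exprNn xM mulr0 => /(_ erefl).
have -> : (- x) ^+ 2 = x ^+ 2 by ring.
have -> : (- x) ^+ 4 = x ^+ 4 by ring.
have -> : (- x) ^+ 8 = x ^+ 8 by ring.
move: phi.
have := qpochN x (x ^+ 2) M; rewrite -exprM.
have := qpochN (x ^+ 2) (x ^+ 2) M; rewrite -!exprM.
have := qpochN (x ^+ 4) (x ^+ 4) M; rewrite -!exprM.
have := qpoch_dissect (- x ^+ 2) (nil 2 isT); rewrite -!exprM mulNr -exprD.
have := qpoch_dissect (x ^+ 4) (nil 4 isT); rewrite -!exprM -exprD.
have E2reg : GRing.lreg (qpoch (- x ^+ 2) (x ^+ 2) M).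
  by apply: (@lreg_qpoch _ _ M); rewrite ?nil // exprNn nil // mulr0.
move: E2reg.
rewrite !(muln2, mul2n, addn2, add2n) /=.
set a := qpoch x _ _; set a' := qpoch (- x) _ _; set b := qpoch (x ^+ 2) _ _.
set c := qpoch (x ^+ 4) (x ^+ 4) _; set E2 := qpoch (- x ^+ 2) (x ^+ 2) _.
set E4 := qpoch (- x ^+ 4) (x ^+ 4) _; set E8 := qpoch (- x ^+ 8) (x ^+ 8) _.
set c1 := qpoch (x ^+ 4) (x ^+ 8) _; set c2 := qpoch (x ^+ 8) (x ^+ 8) _.
move=> E2reg cE E2E E8E E4E aa' phi phi'.
(* Euler's identity (-x; x) (x; x^2) = 1. *)
have aa'b : a * a' * b = 1.
  apply: (E2reg); rewrite mulr1 [RHS]E2E -aa' -E4E; ring.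
have a4 : a ^+ 4 - a' ^+ 4 = 8%:R * x * (b ^+ 2 * c ^+ 4).
  apply: (E2reg); apply: E2reg.
  transitivity ((a ^+ 2 * E2) ^+ 2 - (a' ^+ 2 * E2) ^+ 2); first by ring.
  by rewrite phi phi' -E8E -E4E cE; ring.
transitivity ((a * a' * b) ^+ 4 + a ^+ 4 * b ^+ 4 * (a ^+ 4 - a' ^+ 4)).
  by ring.
by rewrite aa'b a4 expr1n; ring.
Qed.

(** * The two generating products *)

(** The length [M.*2.*2] is divisible by 4, as the even parts of the second
    product are split once more by parity. *)
Lemma prod_copiesS x M : x ^+ M = 0 ->
  \prod_(n < M.*2.*2) (1 + x ^+ n.+1) ^+ copiesS n.+1 =
  qpoch x (x ^+ 2) M ^+ 8 * qpoch (x ^+ 2) (x ^+ 2) M ^+ 4.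
Proof.
move=> xM; have nil := nilp_exprX xM; have MM : (M <= M.*2)%N by lia.
rewrite (big_ord_double _ (fun n => (1 + x ^+ n.+1) ^+ copiesS n.+1)) /=.
rewrite -!(qpoch_stable _ (nil 2 isT) MM) /qpoch -!prodrXl.
by congr (_ * _); apply: eq_bigr => i _; rewrite /copiesS /= odd_double /=;
  rewrite -exprM mul2n -?exprS -?exprD.
Qed.

(** Multiples of 4 have 10 = 6 + 4 copies: 6 of them join the other even parts
    and the remaining 4 give the last factor. *)
Lemma prod_copiesT x M : x ^+ M = 0 ->
  \prod_(n < M.*2.*2) (1 + x ^+ n.+1) ^+ copiesT n.+1 =
  qpoch x (x ^+ 2) M ^+ 4 * qpoch (x ^+ 2) (x ^+ 2) M ^+ 6
    * qpoch (x ^+ 4) (x ^+ 4) M ^+ 4.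
Proof.
move=> xM; have nil := nilp_exprX xM; have MM : (M <= M.*2)%N by lia.
rewrite (big_ord_double _ (fun n => (1 + x ^+ n.+1) ^+ copiesT n.+1)) /= -mulrA.
congr (_ * _).
  rewrite -(qpoch_stable _ (nil 2 isT) MM) /qpoch -prodrXl.
  apply: eq_bigr => i _.
  by rewrite /copiesT /= odd_double /= -exprM mul2n -exprS.
rewrite -(qpoch_stable (x ^+ 2) (nil 2 isT) MM) /qpoch -prodrXl.
rewrite (big_ord_double _ (fun n => (1 + x ^+ n.*2.+2) ^+ copiesT n.*2.+2)) /=.
rewrite (big_ord_double _ (fun n => (1 + x ^+ 2 * x ^+ 2 ^+ n) ^+ 6)) /=.
rewrite -mulrA -prodrXl; congr (_ * _); last rewrite -big_split /=;
  apply: eq_bigr => i _.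
  rewrite /copiesT /= odd_double /= -exprM -exprD mul2n add2n.
  by have -> : (4 %| i.*2.*2.+2)%N = false by lia.
rewrite /copiesT /= odd_double /= -!exprM -!exprD.
have -> : (4 %| i.*2.+1.*2.+2)%N by lia.
have -> : (2 + 2 * i.*2.+1 = i.*2.+1.*2.+2)%N by lia.
have -> : (4 + 4 * i = i.*2.+1.*2.+2)%N by lia.
by rewrite -exprD.
Qed.

End QSeries.

(** * Counting partitions by generating functions *)

Section Counting.

Local Open Scope fset_scope.
Local Open Scope ring_scope.

(** Expanding the product means choosing, for each element of S, whether it
    belongs to the subset. *)
Lemma sum_fpowerset_prod (R : comNzRingType) (T : choiceType) (F : T -> R)
    (S : {fset T}) :
  \sum_(A <- fpowerset S) \prod_(x <- A) F x = \prod_(x <- S) (1 + F x).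
Proof.
elim/finSet_rect: S => S IHS.
have [->|[y yS]] := fset_0Vmem S.
  by rewrite fpowerset0 big_seq_fset1 !big_seq_fset0.
rewrite (big_fsetD1 y) //= -(IHS (S `\ y)%fset); last by rewrite fproperD1.
rewrite mulrDl mul1r (big_fsetID _ (fun A : {fset T} => y \notin A)) /=.
congr (_ + _).
  by apply: eq_fbigl => A; rewrite !inE /= !fpowersetE fsubsetD1.
rewrite mulr_sumr.
have -> : [fset A in fpowerset S | ~~ (y \notin A)]%fset
    = [fset y |` A | A in fpowerset (S `\ y)]%fset.
  apply/fsetP => A; rewrite !inE /= fpowersetE negbK.
  apply/andP/imfsetP => /=.
    move=> [AS yA]; exists (A `\ y)%fset; last by rewrite fsetD1K.
    by rewrite fpowersetE fsetSD.
  move=> [B]; rewrite fpowersetE fsubsetD1 => /andP[BS yB] ->.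
  by rewrite fsubUset fsub1set yS BS fset1U1.
rewrite big_imfset /=; last first.
  move=> A B; rewrite !fpowersetE !fsubsetD1 => /andP[_ yA] /andP[_ yB] AB.
  by rewrite -(fsetU1K yA) -(fsetU1K yB) AB.
rewrite big_seq [in RHS]big_seq; apply: eq_bigr => A.
rewrite fpowersetE fsubsetD1 => /andP[_ yA].
by rewrite big_fsetU1.
Qed.

Lemma prod_colored_upto (R : comNzRingType) copies K (F : nat -> R) :
  \prod_(x <- colored_upto copies K) F (value x) =
  \prod_(n < K) F n.+1 ^+ copies n.+1.
Proof.
rewrite /colored_upto big_imfset /=; last by move=> ? ? _ _.
rewrite undup_id; last first.
  apply: allpairs_uniq_dep.
  - exact: iota_uniq.
  - by move=> ? _; exact: iota_uniq.
  - by move=> [? ?] [? ?] _ _ /= [-> ->].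
rewrite big_allpairs_dep /=.
have -> : iota 1 K = index_iota 1 K.+1 by rewrite /index_iota subn1.
rewrite big_add1 /= big_mkord; apply: eq_bigr => n _.
rewrite /value /= big_const_seq count_predT size_iota.
by elim: (copies _) => //= m ->; rewrite exprS.
Qed.

Definition partition_gf copies K : {poly int} :=
  \prod_(n < K) (1 + 'X^(n.+1)) ^+ copies n.+1.

(** Parts larger than N contribute to no coefficient of index at most N, hence
    the freedom in the choice of K. *)
Lemma coef_partition_gf copies K N : (N <= K)%N ->
  (partition_gf copies K)`_N = (num_partitions copies N)%:R.
Proof.
move=> NK; pose F n : {poly int} := 'X^n.
rewrite /partition_gf -(prod_colored_upto copies K (fun n => 1 + F n)).
rewrite -(sum_fpowerset_prod (fun x => F (value x))) coef_sum.
have -> : num_partitions copies N = #|` [fset A in fpowerset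
    (colored_upto copies K) | (\sum_(x <- A) value x == N)%N]|%fset.
  congr #|` _|%fset; apply/fsetP => A; apply/partitionsP/idP.
    move=> [AS AN]; rewrite !inE /= AN eqxx andbT fpowersetE.
    apply/fsubsetP => x xA; rewrite in_colored_upto AS //= (leq_trans _ NK) //.
    by rewrite -AN (big_rem x) //= leq_addr.
  rewrite !inE /= fpowersetE => /andP[/fsubsetP AK /eqP AN].
  by split=> // x /AK; rewrite in_colored_upto => /andP[].
rewrite card_fset_sum1 big_fset /= natr_sum [in RHS]big_mkcond /=.
by apply: eq_bigr => A _; rewrite /F prodrXr coefXn eq_sym; case: eqP.
Qed.

(** * Transfer to the truncated polynomial ring *)

Lemma in_qpoly_coef (R : comNzRingType) (p q : {poly R}) n i :
  in_qpoly 'X^(n.+1) p = in_qpoly 'X^(n.+1) q -> (i <= n)%N -> p`_i = q`_i.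
Proof.
move=> pq ilt.
have := congr1 (fun r : {poly %/ 'X^(n.+1)} => (r : {poly R})`_i) pq.
have H : mk_monic ('X^(n.+1) : {poly R}) = 'X^(n.+1) by rewrite mk_monic_Xn.
by rewrite /= !H -!Pdiv.RingMonic.take_poly_rmodp !coef_take_poly ltnS ilt.
Qed.

Lemma in_qpolyX_nilp (R : comNzRingType) n :
  (in_qpoly 'X^(n.+1) 'X : {poly %/ 'X^(n.+1) : {poly R}}) ^+ n.+1 = 0.
Proof.
rewrite -rmorphXn /=; apply/val_inj => /=.
rewrite mk_monic_Xn -Pdiv.RingMonic.take_poly_rmodp; apply/polyP => i.
by rewrite coef_take_poly coefXn coef0; case: ltngtP.
Qed.

End Counting.

Theorem theorem3p14 (N : nat) (hN : 1 <= N) : D_S N = 8 * D_T (N - 1).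
Proof.
set K := N.+1.*2.*2.
have gf : ((partition_gf copiesS K)`_N
    = (1 + 8%:R * 'X * partition_gf copiesT K)`_N)%R.
  apply: (@in_qpoly_coef _ _ _ N) => //.
  have := in_qpolyX_nilp int N; set x := in_qpoly _ _ => xN.
  rewrite rmorphD !rmorphM rmorph1 rmorph_nat /= -/x.
  have gfE copies : in_qpoly 'X^(N.+1) (partition_gf copies K)
      = (\prod_(n < K) (1 + x ^+ n.+1) ^+ copies n.+1)%R.
    rewrite /partition_gf rmorph_prod; apply: eq_bigr => n _.
    by rewrite rmorphXn rmorphD rmorph1 rmorphXn.
  by rewrite !gfE prod_copiesS // prod_copiesT // product_identity.
have NK : N <= K by rewrite /K; lia.
move: gf; rewrite coefD coef1 -mulrA mulr_natl coefMn mulrC coefMX.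
rewrite !coef_partition_gf; try lia.
case: N hN {K NK} => // n _; rewrite /= add0r subn1 /= -mulrnA => /eqP.
by rewrite Num.Theory.eqr_nat mulnC => /eqP.
Qed.
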